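(* The map $\Psi$ defined on $\mathcal D$ by $$\Psi(\pi_1,\pi_2):=\pi_1\nearrow\pi_2+(\mathrm{Leb}_{[0,1]}-\pi_1)\nearrow(\mathrm{Leb}_{[0,1]}-\pi_2)$$ is a continuous surjection from $\mathcal D$ to the set of $321$-avoiding permutons.
   Context: A permuton is a Borel probability measure $\mu$ on $[0,1]^2$ whose two marginals are the Lebesgue measure on $[0,1]$; the set of permutons has the topology of weak convergence. A permuton $\mu$ is $321$-avoiding if its density of the pattern $321$ is zero, i.e. $\mu^{\otimes3}\big(\{((x_i,y_i))_{1\le i\le 3}: x_1<x_2<x_3,\ y_1>y_2>y_3\}\big)=0$. $\mathcal M([0,1])$ is the space of finite Borel measures on $[0,1]$ with the topology of weak convergence; $\pi\le\mathrm{Leb}$ means $\pi(A)\le\mathrm{Leb}(A)$ for every Borel set $A\subseteq[0,1]$. Define $$\mathcal D:=\left\{(\pi_1,\pi_2)\in\mathcal M([0,1])^2:\ \pi_1\le\mathrm{Leb},\ \pi_2\le\mathrm{Leb},\ \pi_1([0,1])=\pi_2([0,1]),\ \forall x\in[0,1],\ \pi_1([0,x])\le\pi_2([0,x])\right\}.$$ A subset $S\subseteq\mathbb R^2$ is nondecreasing if $(x_1-x_2)(y_1-y_2)\ge0$ for all $(x_1,y_1),(x_2,y_2)\in S$. For two finite measures $\mu,\nu$ on $[0,1]$ with the same total mass, $\mu\nearrow\nu$ is the unique measure on $[0,1]^2$ with first marginal $\mu$, second marginal $\nu$, and nondecreasing support (the nondecreasing coupling; it is the zero measure if the total mass is $0$).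 Equivalently, if the total mass is $M>0$, $\mu\nearrow\nu=M\cdot(G_{\mu/M},G_{\nu/M})_\#\mathrm{Leb}_{[0,1]}$, where $G_\rho(u)=\sup\{x:\rho([0,x])\le u\}$ is the quantile function and $\#$ denotes push-forward. *)

(* Defs.v *)
From HB Require Import structures.
From mathcomp Require Import all_boot all_order all_algebra.
From mathcomp Require Import all_classical all_reals all_analysis.

Set Implicit Arguments.
Unset Strict Implicit.
Unset Printing Implicit Defensive.

Import Order.TTheory GRing.Theory Num.Theory.
Import numFieldNormedType.Exports.

Local Open Scope classical_set_scope.
Local Open Scope ring_scope.

(* A finite measure on a measurable subset K of T is encoded as a finite measure
   on T giving no mass to the complement of K. Values on non-measurable sets
   are unconstrained, so equality of measures always means [eq_meas]. *)
Record fmeas d (T : measurableType d) (R : realType) (K : set T) := FMeas {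
  fmeas_measure :> {finite_measure set T -> \bar R};
  fmeas_conc : fmeas_measure (~` K) = 0%E }.

Definition eq_meas d (T : measurableType d) (R : realType)
    (mu nu : set T -> \bar R) : Prop :=
  forall A, measurable A -> mu A = nu A.

Section fmeas_ops.
Local Open Scope ereal_scope.
Context d (T : measurableType d) (R : realType) (K : set T).

Definition fmeas0 : fmeas R K :=
  @FMeas d T R K (mzero : {finite_measure set T -> \bar R}) erefl.

Variables mu nu : fmeas R K.

Let add_fin : fin_num_fun (measure_add mu nu).
Proof.
by move=> A mA; rewrite measure_addE fin_numD !fin_num_measure.
Qed.

HB.instance Definition _ := Measure.on (measure_add mu nu).
HB.instance Definition _ :=
  @Measure_isFinite.Build _ T R (measure_add mu nu) add_fin.

Let add_conc : measure_add mu nu (~` K) = 0.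
Proof.
by rewrite measure_addE -[RHS]adde0; congr (_ + _); exact: fmeas_conc.
Qed.

Definition fmeas_add : fmeas R K :=
  @FMeas d T R K (measure_add mu nu : {finite_measure set T -> \bar R})
    add_conc.

End fmeas_ops.

Section unit_interval.
Context (R : realType).

Definition I01 : set R := `[0, 1].
Definition I01sq : set (R * R) := I01 `*` I01.

Definition M01 : Type := fmeas R I01.
Definition M01sq : Type := fmeas R I01sq.

HB.instance Definition _ := gen_eqMixin M01.
HB.instance Definition _ := gen_choiceMixin M01.
HB.instance Definition _ := gen_eqMixin M01sq.
HB.instance Definition _ := gen_choiceMixin M01sq.

Definition C01 : Type := {f : R -> R | {within I01, continuous f}}.
Definition C01sq : Type := {f : R * R -> R | {within I01sq, continuous f}}.

HB.instance Definition _ := gen_eqMixin C01.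
HB.instance Definition _ := gen_choiceMixin C01.
HB.instance Definition _ := gen_eqMixin C01sq.
HB.instance Definition _ := gen_choiceMixin C01sq.

Definition M01_int (mu : M01) : {ptws C01 -> R} :=
  fun f => \int[mu]_(x in I01) (sval f x).
Definition M01sq_int (mu : M01sq) : {ptws C01sq -> R} :=
  fun f => \int[mu]_(x in I01sq) (sval f x).

(* Weak convergence: the initial topology for integration against continuous
   functions on I01 (resp. I01sq), bounded by compactness. *)
HB.instance Definition _ := Topological.copy M01 (initial_topology M01_int).
HB.instance Definition _ := Topological.copy M01sq (initial_topology M01sq_int).

Definition le_leb (pi : M01) : Prop :=
  forall A : set R, measurable A -> A `<=` I01 ->
    (pi A <= lebesgue_measure A)%E.

Definition calD : set (M01 * M01) := [set p |
  [/\ le_leb p.1, le_leb p.2, p.1 I01 = p.2 I01 &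
      forall x : R, I01 x -> (p.1 `[0%R, x]%classic <= p.2 `[0%R, x]%classic)%E]].

(* Leb_[0,1] - pi, determined on Borel sets when [le_leb pi]
   (junk value 0 otherwise). *)
Definition leb_sub (pi : M01) : M01 :=
  xget (fmeas0 R I01 : M01) [set rho : M01 | forall A : set R, measurable A ->
    rho A = (lebesgue_measure (A `&` I01) - pi A)%E].

(* Topological support: the smallest closed set of full measure. *)
Definition msupport (gamma : set (R * R) -> \bar R) : set (R * R) :=
  [set p | forall U, open U -> U p -> (0 < gamma U)%E].

Definition nondecreasing_set (S : set (R * R)) : Prop :=
  forall p q, S p -> S q -> 0 <= (p.1 - q.1) * (p.2 - q.2).

Definition is_nd_coupling (mu nu : M01) (gamma : M01sq) : Prop :=
  [/\ forall A : set R, measurable A -> pushforward gamma fst A = mu A,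
      forall A : set R, measurable A -> pushforward gamma snd A = nu A &
      nondecreasing_set (msupport gamma)].

(* The nondecreasing coupling, determined on Borel sets when mu and nu have the
   same total mass (junk value 0 otherwise). *)
Definition nd_coupling (mu nu : M01) : M01sq :=
  xget (fmeas0 R I01sq : M01sq) [set gamma : M01sq | is_nd_coupling mu nu gamma].

Definition Psi (p : M01 * M01) : M01sq :=
  fmeas_add (nd_coupling p.1 p.2) (nd_coupling (leb_sub p.1) (leb_sub p.2)).

Definition permuton : set M01sq := [set mu |
  [/\ mu I01sq = 1%E,
      forall A : set R, measurable A ->
        pushforward mu fst A = lebesgue_measure (A `&` I01) &
      forall A : set R, measurable A ->
        pushforward mu snd A = lebesgue_measure (A `&` I01)]].

Definition pattern321 : set ((R * R) * (R * R) * (R * R)) :=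
  [set t | let: (p1, p2, p3) := t in
    (p1.1 < p2.1 < p3.1) && (p3.2 < p2.2 < p1.2)].

Definition permuton321 : set M01sq := permuton `&`
  [set mu | ((mu \x mu)%E \x mu)%E pattern321 = 0%E].

End unit_interval.

(* Main.v *)
Require Import Defs.
From HB Require Import structures.
From mathcomp Require Import all_boot all_order all_algebra.
From mathcomp Require Import all_classical all_reals all_analysis.
From mathcomp Require Import measurable_realfun lra.

Set Implicit Arguments.
Unset Strict Implicit.
Unset Printing Implicit Defensive.

Import Order.TTheory GRing.Theory Num.Theory.
Import numFieldNormedType.Exports.

Local Open Scope classical_set_scope.
Local Open Scope ring_scope.

(** Everything is read off the masses of quadrants. Write [NW a b], [SE a b]
    and [SW a b] for the upper left, lower right and lower left quadrants with
    corner [(a, b)].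

    Couplings. A measure on the plane has nondecreasing support iff for every
    corner one of [NW a b], [SE a b] is null ([nondecreasing_comonotone]): two
    support points in decreasing position are separated by a corner, and a
    non-null set meets the support. If [mu] and [nu] are the marginals, such a
    measure gives [SW a b] the mass [min (mu (-oo, a]) (nu (-oo, b])]
    ([comonotone_SW]). Quadrants [SW a b] determine a finite measure, so the
    nondecreasing coupling is unique; the pair of quantile functions pushes
    Lebesgue measure to one, so it exists ([nd_coupling_exists]). Hence [Psi p]
    has an explicit joint distribution function ([Psi_SW]).

    Values of [Psi]. The pattern 321 is a countable union of products of three
    rectangles in decreasing position, so a measure avoids it iff one rectangle
    of every such triple is null ([pattern321_null]). If a sum of two comonotone
    measures charged all three rectangles, one of the two would charge two of
    them by the pigeonhole principle, which is impossible
    ([comonotone_add_avoiding]).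

    Surjectivity. Cut a 321-avoiding permuton along the diagonal, into its part
    on [y <= x] and its part on [x < y]. Each part is comonotone. Indeed, both
    marginals being uniform, [NW s s] and [SE s s] have the same mass; if the
    part on [x <= y] charged a decreasing pair [NW a b], [SE a b], then it would
    charge a thin vertical slice of [SE a b] around some [x = s], with
    [a <= s <= b], and the lower right of that slice has nearly the mass of
    [SE s s], which is the mass of [NW s s], at least that of [NW a b]: this
    third rectangle completes a 321 ([above_comonotone]). The part on [y <= x]
    is symmetric. The marginals of that part form the element of [calD] sought:
    there [x <= t] forces [y <= t], which is the inequality between the
    distribution functions. Uniqueness of couplings identifies [Psi] of it with
    the permuton ([Psi_surjective]).

    Continuity. Measures below Lebesgue measure have 1-Lipschitz distribution
    functions, so the value at a point of the distribution function is a uniform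
    limit, over such measures, of integrals of continuous ramps, and is
    therefore weakly continuous ([cdf1_cvg]). By the formula for the joint
    distribution function, the mass that [Psi p] gives to a half-open rectangle
    is continuous in [p]. A continuous function on the square is within [e] of a
    step function on a fine grid of such rectangles, uniformly, and [Psi p] has
    mass 1, so the integrals converge as well ([Psi_int_cvg]). *)

(** * Quadrants and comonotone measures *)

Section null_sets.
Context (R : realType).
Local Open Scope ereal_scope.

Lemma null_sub d (T : measurableType d) (m : {measure set T -> \bar R})
    (A B : set T) :
  measurable A -> measurable B -> A `<=` B -> m B = 0 -> m A = 0.
Proof.
move=> mA mB AB B0; apply/eqP; rewrite eq_le measure_ge0 andbT -B0.
by rewrite le_measure ?inE.
Qed.

End null_sets.

Section quadrants.
Context (R : realType).
Implicit Types (a b : R) (g : set (R * R) -> \bar R).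

Definition NW a b : set (R * R) := `]-oo, a]%classic `*` `]b, +oo[%classic.
Definition SE a b : set (R * R) := `]a, +oo[%classic `*` `]-oo, b]%classic.
Definition SW a b : set (R * R) := `]-oo, a]%classic `*` `]-oo, b]%classic.

Lemma NWE a b p : NW a b p = ((p.1 <= a) && (b < p.2)) :> Prop.
Proof.
apply/propext; rewrite /NW /setX /= !in_itv/= andbT.
by split=> [[-> ->]|/andP[-> ->]].
Qed.

Lemma SEE a b p : SE a b p = ((a < p.1) && (p.2 <= b)) :> Prop.
Proof.
apply/propext; rewrite /SE /setX /= !in_itv/= andbT.
by split=> [[-> ->]|/andP[-> ->]].
Qed.

Lemma SWE a b p : SW a b p = ((p.1 <= a) && (p.2 <= b)) :> Prop.
Proof.
apply/propext; rewrite /SW /setX /= !in_itv/=.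
by split=> [[-> ->]|/andP[-> ->]].
Qed.

Lemma measurable_NW a b : measurable (NW a b).
Proof. exact: measurableX. Qed.

Lemma measurable_SE a b : measurable (SE a b).
Proof. exact: measurableX. Qed.

Lemma measurable_SW a b : measurable (SW a b).
Proof. exact: measurableX. Qed.

(** Nondecreasing support, in terms of masses only: see
    [nondecreasing_comonotone]. *)
Definition comonotone g :=
  forall a b, g (NW a b) = 0%E \/ g (SE a b) = 0%E.

Definition has_marginals (mu nu : set R -> \bar R) g :=
  (forall A, measurable A -> pushforward g fst A = mu A) /\
  (forall A, measurable A -> pushforward g snd A = nu A).

End quadrants.

#[export] Hint Extern 0 (measurable (NW _ _)) => exact: measurable_NW : core.
#[export] Hint Extern 0 (measurable (SE _ _)) => exact: measurable_SE : core.
#[export] Hint Extern 0 (measurable (SW _ _)) => exact: measurable_SW : core.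

Section joint_cdf.
Context (R : realType).
Local Open Scope ereal_scope.
Implicit Types (g : {finite_measure set (R * R)%type -> \bar R}).

Lemma measure_fst_ray g a b :
  g (fst @^-1` `]-oo, a]%classic) = g (SW a b) + g (NW a b).
Proof.
rewrite -measureU//; last first.
  apply/seteqP; split=> // p [] /=; rewrite SWE NWE.
  by move=> /andP[_ yb] /andP[_]; rewrite ltNge yb.
congr (g _); apply/seteqP; split=> p /=; rewrite in_itv/= SWE NWE.
  by move=> ->; rewrite ltNge; case: (p.2 <= b)%R; [left|right].
by case=> /andP[].
Qed.

Lemma measure_snd_ray g a b :
  g (snd @^-1` `]-oo, b]%classic) = g (SW a b) + g (SE a b).
Proof.
rewrite -measureU//; last first.
  apply/seteqP; split=> // p [] /=; rewrite SWE SEE.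
  by move=> /andP[yb _] /andP[+ _]; rewrite ltNge yb.
congr (g _); apply/seteqP; split=> p /=; rewrite in_itv/= SWE SEE.
  by move=> ->; rewrite ltNge; case: (p.1 <= a)%R; [left|right].
by case=> /andP[].
Qed.

(** If [NW a b] is null, then all the mass over the ray [x <= a] lies in
    [SW a b], which is then the smaller of the two marginal masses; and
    symmetrically if [SE a b] is null. *)
Lemma comonotone_SW (mu nu : set R -> \bar R) g a b :
  has_marginals mu nu g -> comonotone g ->
  g (SW a b) = Order.min (mu `]-oo, a]%classic) (nu `]-oo, b]%classic).
Proof.
move=> [g1 g2] gco.
have E1 := measure_fst_ray g a b; rewrite [LHS]g1// in E1.
have E2 := measure_snd_ray g a b; rewrite [LHS]g2// in E2.
rewrite E1 E2; case: (gco a b) => ->; rewrite adde0.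
  by rewrite min_l// leeDl.
by rewrite min_r// leeDl.
Qed.

End joint_cdf.

(** * Measures determined by their distribution function *)

Section cdf_uniqueness.
Context (R : realType).
Local Open Scope ereal_scope.

Lemma ray_cover : \bigcup_k `]-oo, k%:R]%classic = [set: R].
Proof.
apply/seteqP; split=> // x _; exists (Num.truncn `|x|%R).+1 => //=.
rewrite in_itv/= (le_trans (ler_norm _))// ltW//.
exact: truncnS_gt.
Qed.

Lemma measure_eq_cdf (m1 m2 : {measure set R -> \bar R}) :
  (forall x : R, m1 `]-oo, x]%classic < +oo) ->
  (forall x : R, m1 `]-oo, x]%classic = m2 `]-oo, x]%classic) ->
  forall A, measurable A -> m1 A = m2 A.
Proof.
move=> fin m12.
apply: (measure_unique [set A | exists x : R, A = `]-oo, x]%classic]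
  (fun k => `]-oo, k%:R]%classic)).
- rewrite eqEsubset; split => A.
    apply: smallest_sub; first exact: smallest_sigma_algebra.
    move=> _ [[a b] _ <-] /=.
    pose S := g_sigma_algebraType [set A | exists x : R, A = `]-oo, x]%classic].
    have -> : `]a, b]%classic = `]-oo, b] `\` `]-oo, a] :> set R.
      apply/seteqP; split=> t /=; rewrite !in_itv/=.
        by move=> /andP[at_ tb]; split=> //; apply/negP; rewrite -ltNge.
      by move=> [-> /negP]; rewrite -ltNge => ->.
    apply: (@measurableD _ S); apply: sub_sigma_algebra; first by exists b.
    by exists a.
  apply: smallest_sub; first exact: sigma_algebra_measurable.
  by move=> _ [x ->]; exact: measurable_itv.
- move=> _ _ [x ->] [y ->]; exists (Order.min x y).
  by apply/seteqP; split=> t /=; rewrite !in_itv/= le_min => /andP.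
- by move=> i; exists i%:R.
- exact: ray_cover.
- by move=> _ [x ->].
- by move=> k; exact: fin.
Qed.

(** The theorem on the line, applied to each coordinate in turn: first the
    strips [_ * (-oo, b]] as measures in the first coordinate, then the strips
    [A * _] in the second one. Measurable rectangles generate the product. *)
Lemma measure_eq_SW (m1 m2 : {finite_measure set (R * R)%type -> \bar R}) :
  (forall a b : R, m1 (SW a b) = m2 (SW a b)) ->
  forall A, measurable A -> m1 A = m2 A.
Proof.
move=> m12.
have finT (m : {finite_measure set (R * R)%type -> \bar R}) A :
  measurable A -> m A < +oo by move=> mA; rewrite ltey_eq fin_num_measure.
have step1 A b : measurable A ->
    m1 (A `*` `]-oo, b]%classic) = m2 (A `*` `]-oo, b]%classic).
  move=> mA; have mD : measurable (setT `*` `]-oo, b]%classic : set (R * R)).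
    exact: measurableX.
  have E (m : set (R * R) -> \bar R) B :
      pushforward (mrestr m mD) fst B = m (B `*` `]-oo, b]%classic).
    by rewrite /pushforward /mrestr; congr (m _); apply/seteqP;
       split=> -[x y] /=; tauto.
  rewrite -!E; apply: measure_eq_cdf => // x; rewrite /= !E; last exact: m12.
  by apply: finT; exact: measurableX.
have step2 A B : measurable A -> measurable B -> m1 (A `*` B) = m2 (A `*` B).
  move=> mA mB; have mD : measurable (A `*` setT : set (R * R)).
    exact: measurableX.
  have E (m : set (R * R) -> \bar R) C :
      pushforward (mrestr m mD) snd C = m (A `*` C).
    by rewrite /pushforward /mrestr; congr (m _); apply/seteqP;
       split=> -[x y] /=; tauto.
  rewrite -!E; apply: measure_eq_cdf => // x; rewrite /= !E; last exact: step1.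
  by apply: finT; exact: measurableX.
apply: (measure_unique [set A `*` B | A in measurable & B in measurable]
  (fun=> setT)).
- exact: measurable_prod_measurableType.
- move=> _ _ [A mA [B mB <-]] [A' mA' [B' mB' <-]]; rewrite -setXI.
  by exists (A `&` A'); [exact: measurableI|];
     exists (B `&` B'); [exact: measurableI|].
- by move=> _; exists setT => //; exists setT => //; rewrite setXTT.
- by rewrite bigcup_const.
- by move=> _ [A mA [B mB <-]]; exact: step2.
- by move=> _; exact: finT.
Qed.

End cdf_uniqueness.

(** * The support of a measure on the plane *)

Section support.
Context (R : realType).

Lemma open_setX (A B : set R) : open A -> open B -> open (A `*` B).
Proof.
move=> oA oB; rewrite openE => -[x y] [/= Ax By].
exists (A, B) => //; split; exact: open_nbhs_nbhs.
Qed.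

(** An enumeration of the quadruples of rationals, so that unions over them are
    unions over [nat]. *)
Definition rat4 (n : nat) : rat * rat * (rat * rat) :=
  odflt (0, 0, (0, 0)) (unpickle n).

Lemma rat4_surj q : exists n, rat4 n = q.
Proof. by exists (pickle q); rewrite /rat4 pickleK. Qed.

Definition ratbox (n : nat) : set (R * R) := let q := rat4 n in
  `]ratr q.1.1, ratr q.1.2[%classic `*` `]ratr q.2.1, ratr q.2.2[%classic.

Lemma measurable_ratbox n : measurable (ratbox n).
Proof. exact: measurableX. Qed.

Lemma rat_between (x y : R) : x < y -> exists q : rat, x < ratr q < y.
Proof. by move=> /rat_in_itvoo[q]; rewrite in_itv/=; exists q. Qed.

Lemma rat_itv_nbhs (x : R) A : nbhs x A ->
  exists q : rat * rat, ratr q.1 < x < ratr q.2 /\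
    `]ratr q.1, ratr q.2[%classic `<=` A.
Proof.
move=> /nbhs_ballP[e /= e0 xeA].
have /rat_between[q1 /andP[eq1 q1x]] : x - e < x by rewrite ltrBlDr ltrDl.
have /rat_between[q2 /andP[xq2 q2e]] : x < x + e by rewrite ltrDl.
exists (q1, q2); split=> /=; first by rewrite q1x.
move=> t /=; rewrite in_itv/= => /andP[q1t tq2]; apply: xeA => /=.
by rewrite /ball/= distrC ltr_distl (lt_trans eq1)// (lt_trans tq2).
Qed.

Lemma open_ratbox (U : set (R * R)) p : open U -> U p ->
  exists n, ratbox n p /\ ratbox n `<=` U.
Proof.
move=> oU Up; have [[A B] /= [nA nB] ABU] : nbhs p U by exact: open_nbhs_nbhs.
have [q1 [q1p q1A]] := rat_itv_nbhs nA.
have [q2 [q2p q2B]] := rat_itv_nbhs nB.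
have [n nq] := rat4_surj (q1, q2); exists n; rewrite /ratbox nq.
split; first by split; rewrite /= in_itv.
by move=> t [t1 t2]; apply: ABU; split; [exact: q1A|exact: q2B].
Qed.

Lemma open_measurable2 (U : set (R * R)) : open U -> measurable U.
Proof.
move=> oU.
have -> : U = \bigcup_(n in [set n | ratbox n `<=` U]) ratbox n.
  apply/seteqP; split=> [p Up|p [n nU np]]; last exact: nU.
  by have [n [np nU]] := open_ratbox oU Up; exists n.
by apply: bigcup_measurable => n _; exact: measurable_ratbox.
Qed.

Local Open Scope ereal_scope.

(** Off the support, every point lies in a null rational box, and there are
    only countably many of those. *)
Lemma msupport_meets (g : {measure set (R * R)%type -> \bar R}) A :
  measurable A -> 0 < g A -> exists2 p, A p & msupport g p.
Proof.
move=> mA; apply: contraPP => noA.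
suff -> : g A = 0 by rewrite ltxx.
apply/(@negligibleP _ _ _ g) => //.
pose N n := if g (ratbox n) == 0 then ratbox n else set0.
apply: (@negligibleS _ _ _ _ (\bigcup_n N n)).
  move=> p Ap; apply: contrapT => pn; apply: noA; exists p => // U oU Up.
  have [n [np nU]] := open_ratbox oU Up.
  rewrite lt0e measure_ge0 andbT; apply/negP => /eqP gU0; apply: pn.
  exists n => //=; rewrite /N ifT// eq_le measure_ge0 andbT -gU0.
  by rewrite le_measure// inE; [exact: measurable_ratbox|exact: open_measurable2].
apply: negligible_bigcup => n; rewrite /N; case: ifPn => [/eqP n0|_].
  by apply/negligibleP => //; exact: measurable_ratbox.
exact: negligible_set0.
Qed.

(** A support point in each of [NW a b] and [SE a b] gives a decreasing pair.
    Conversely, a decreasing pair of support points has a rational corner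
    strictly between them, and open neighbourhoods of positive mass inside the
    two quadrants. *)
Lemma nondecreasing_comonotone (g : {measure set (R * R)%type -> \bar R}) :
  nondecreasing_set (msupport g) <-> comonotone g.
Proof.
split=> [ndg a b|cog p q sp sq].
  apply: contrapT => /not_orP[/eqP NW0 /eqP SE0].
  have NW_gt0 : 0 < g (NW a b) by rewrite lt0e NW0 measure_ge0.
  have SE_gt0 : 0 < g (SE a b) by rewrite lt0e SE0 measure_ge0.
  have [p] := msupport_meets (measurable_NW a b) NW_gt0; rewrite NWE => + sp.
  have [q] := msupport_meets (measurable_SE a b) SE_gt0; rewrite SEE => + sq.
  move=> /andP[aq qb] /andP[pa bp].
  have := ndg _ _ sp sq; rewrite leNgt nmulr_rlt0 ?subr_gt0 ?subr_lt0.
    by rewrite (le_lt_trans qb).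
  by rewrite (le_lt_trans pa).
have key p' q' : msupport g p' -> msupport g q' ->
    (p'.1 < q'.1)%R -> (q'.2 < p'.2)%R -> False.
  move=> sp' sq' /rat_between[a /andP[pa aq]] /rat_between[b /andP[qb bp]].
  have [] := cog (ratr a) (ratr b).
    apply/eqP; rewrite gt_eqF//.
    apply: (@lt_le_trans _ _ (g (`]-oo, ratr a[ `*` `]ratr b, +oo[))).
      apply: sp'; last by split; rewrite /= in_itv/= ?andbT.
      by apply: open_setX; [exact: lray_open|exact: rray_open].
    rewrite le_measure// ?inE//; first exact: measurableX.
    by move=> t [/=]; rewrite !in_itv/= andbT NWE => /ltW -> ->.
  apply/eqP; rewrite gt_eqF//.
  apply: (@lt_le_trans _ _ (g (`]ratr a, +oo[ `*` `]-oo, ratr b[))).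
    apply: sq'; last by split; rewrite /= in_itv/= ?andbT.
    by apply: open_setX; [exact: rray_open|exact: lray_open].
  rewrite le_measure// ?inE//; first exact: measurableX.
  by move=> t [/=]; rewrite !in_itv/= andbT SEE => -> /ltW ->.
have [pq1|pq1|->] := ltgtP p.1 q.1; last by rewrite subrr mul0r.
  have [pq2|pq2] := leP p.2 q.2; last by have := key _ _ sp sq pq1 pq2.
  by rewrite mulr_le0 ?subr_le0// ltW.
have [pq2|pq2] := leP q.2 p.2; last by have := key _ _ sq sp pq1 pq2.
by rewrite mulr_ge0 ?subr_ge0// ltW.
Qed.

End support.

(** * Measures below Lebesgue measure *)

Section sub_lebesgue.
Context (R : realType).
Local Open Scope ereal_scope.
Implicit Types (pi : M01 R) (A : set R).

Lemma measurable_I01 : measurable (@I01 R).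
Proof. exact: measurable_itv. Qed.

Lemma measurable_I01sq : measurable (@I01sq R).
Proof. by apply: measurableX; exact: measurable_I01. Qed.

Lemma fmeasI d (T : measurableType d) (K : set T) (mu : fmeas R K) (A : set T) :
  measurable K -> measurable A -> mu (A `&` K) = mu A.
Proof.
move=> mK mA; rewrite [RHS](measureDI mu mA mK).
rewrite [X in _ = X + _](_ : _ = 0) ?add0e//.
apply/eqP; rewrite eq_le measure_ge0 andbT -(fmeas_conc mu) le_measure ?inE//.
- exact: measurableD.
- exact: measurableC.
Qed.

Lemma fmeas_fin d (T : measurableType d) (K : set T) (mu : fmeas R K) (A : set T) :
  measurable A -> mu A \is a fin_num.
Proof. by move=> mA; exact: fin_num_measure. Qed.

Lemma lebesgue_I01 : lebesgue_measure (@I01 R) = 1.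
Proof. by rewrite /I01 lebesgue_measure_itv/= lte_fin ltr01 oppr0 adde0. Qed.

(** [lebesgue_measure] is a measure for the structure [measurableTypeR R],
    whereas the measures of [M01 R] live on [R] itself, hence a new instance. *)
Definition leb01 A := lebesgue_measure (A `&` @I01 R).

Let leb01_0 : leb01 set0 = 0.
Proof. by rewrite /leb01 set0I measure0. Qed.

Let leb01_ge0 A : 0 <= leb01 A.
Proof. exact: measure_ge0. Qed.

Let leb01_sigma_additive : semi_sigma_additive leb01.
Proof.
have := @measure_semi_sigma_additive _ _ _
  (mrestr (@lebesgue_measure R) measurable_I01).
by rewrite /semi_sigma_additive; exact.
Qed.

HB.instance Definition _ := isMeasure.Build _ R R leb01
  leb01_0 leb01_ge0 leb01_sigma_additive.

Lemma leb01_itv (a b : R) : (0 <= a -> a <= b -> b <= 1 ->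
  leb01 `]a, b] = (b - a)%:E)%R.
Proof.
move=> a0 ab b1; rewrite /leb01 (setIidl _); last first.
  move=> x; rewrite /I01 /= !in_itv/= => /andP[ax xb].
  by rewrite (le_trans a0 (ltW ax)) (le_trans xb b1).
rewrite lebesgue_measure_itv/= lte_fin; case: ltP => // ba.
by rewrite (@le_anti _ _ a b) ?subrr// ab.
Qed.

Lemma leb01_itv_le (a b : R) : (a <= b)%R -> leb01 `]a, b]%classic <= (b - a)%:E.
Proof.
move=> ab; apply: (@le_trans _ _ (lebesgue_measure `]a, b]%classic)).
  apply: (@le_measure _ _ _ (@lebesgue_measure R)); rewrite ?inE//.
  by apply: measurableI => //; exact: measurable_I01.
rewrite lebesgue_measure_itv/= lte_fin; case: ltP => // ba.
by rewrite lee_fin subr_ge0.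
Qed.

Let leb01_fin : fin_num_fun leb01.
Proof.
move=> A mA; rewrite ge0_fin_numE//; apply: (@le_lt_trans _ _ 1); last exact: ltry.
rewrite -lebesgue_I01.
apply: (@le_measure _ _ _ (@lebesgue_measure R)); rewrite ?inE//.
  by apply: measurableI => //; exact: measurable_I01.
exact: measurable_I01.
Qed.

HB.instance Definition _ := Measure_isFinite.Build _ _ _ leb01 leb01_fin.

Lemma le_lebI pi A : le_leb pi -> measurable A ->
  pi A <= leb01 A.
Proof.
move=> le_pi mA; rewrite -(fmeasI pi measurable_I01 mA); apply: le_pi => //.
exact: measurableI measurable_I01.
Qed.

(** The difference is taken among charges, whose value may be constrained on
    measurable sets only; [crestr0] makes it [0], hence nonnegative, on the
    other sets. *)
Section leb_minus.
Variables (pi : M01 R) (le_pi : le_leb pi).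

Let nu0 : {charge set R -> \bar R} :=
  cadd (charge_of_finite_measure leb01) (copp (charge_of_finite_measure pi)).

Let nu : {charge set R -> \bar R} := crestr0 nu0 measurableT.

Let nuE A : measurable A -> nu A = leb01 A - pi A.
Proof.
by move=> mA; rewrite /nu /= /crestr0 mem_set// /crestr setIT /nu0 /= /cadd /copp.
Qed.

Let nu_ge0 A : 0 <= nu A.
Proof.
have [mA|nmA] := pselect (measurable A); last by rewrite /nu /= /crestr0 memNset.
by rewrite nuE// sube_ge0 ?le_lebI// fmeas_fin.
Qed.

Definition leb_minus := measure_of_charge nu nu_ge0.

HB.instance Definition _ := Measure.on leb_minus.

Let leb_minus_fin : fin_num_fun leb_minus.
Proof. by move=> A mA; exact: (fin_num_measure nu). Qed.

HB.instance Definition _ := Measure_isFinite.Build _ _ _ leb_minus leb_minus_fin.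

Lemma leb_minusE A : measurable A -> leb_minus A = leb01 A - pi A.
Proof. exact: nuE. Qed.

End leb_minus.

Lemma leb_sub_exists pi : le_leb pi -> exists rho : M01 R,
  forall A, measurable A -> rho A = leb01 A - pi A.
Proof.
move=> le_pi.
have rhoK : leb_minus le_pi (~` @I01 R) = 0.
  rewrite leb_minusE; last by apply: measurableC; exact: measurable_I01.
  by rewrite /leb01 setICl measure0 fmeas_conc sube0.
by exists (FMeas rhoK) => A mA; rewrite -(leb_minusE le_pi).
Qed.

Lemma leb_subE pi A : le_leb pi -> measurable A ->
  leb_sub pi A = leb01 A - pi A.
Proof.
move=> le_pi; move: A.
exact: (@xgetPex _ (fmeas0 R (@I01 R) : M01 R)
  [set rho : M01 R | forall A : set R, measurable A ->
    rho A = (leb01 A - pi A)%E] (leb_sub_exists le_pi)).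
Qed.

Lemma le_leb_sub pi : le_leb pi -> le_leb (leb_sub pi).
Proof.
move=> le_pi A mA AI; rewrite leb_subE// /leb01 (setIidl AI).
by rewrite leeBlDr ?fmeas_fin// leeDl.
Qed.

Lemma fmeas_I01 (pi : M01 R) : pi (@I01 R) = pi setT.
Proof.
by rewrite -(fmeasI pi measurable_I01 measurableT) setTI.
Qed.

Definition cdf1 (pi : M01 R) (x : R) : R := fine (pi `]-oo, x]%classic).

Lemma cdf1E pi x : pi `]-oo, x]%classic = (cdf1 pi x)%:E.
Proof. by rewrite fineK// fmeas_fin. Qed.

Lemma cdf1_itv pi (x y : R) : (x <= y)%R ->
  pi `]x, y]%classic = (cdf1 pi y - cdf1 pi x)%:E.
Proof.
move=> xy; rewrite EFinB -!cdf1E.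
have -> : `]x, y]%classic = `]-oo, y] `\` `]-oo, x] :> set R.
  apply/seteqP; split=> t /=; rewrite !in_itv/=.
    by move=> /andP[at_ tb]; split=> //; apply/negP; rewrite -ltNge.
  by move=> [-> /negP]; rewrite -ltNge => ->.
rewrite measureD//; last by rewrite ltey_eq fmeas_fin.
by rewrite setIidr// => t /=; rewrite !in_itv/= => /le_trans; apply.
Qed.

Lemma cdf1_le pi (x y : R) : (x <= y -> cdf1 pi x <= cdf1 pi y)%R.
Proof.
move=> xy; rewrite -lee_fin -!cdf1E le_measure ?inE//.
by move=> t /=; rewrite !in_itv/= => /le_trans; apply.
Qed.

Lemma cdf1_lip pi (x y : R) : le_leb pi -> (x <= y)%R ->
  (cdf1 pi y <= cdf1 pi x + (y - x))%R.
Proof.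
move=> le_pi xy; rewrite -lerBlDl -lee_fin -cdf1_itv//.
by rewrite (le_trans (le_lebI le_pi _))// leb01_itv_le.
Qed.

Lemma cdf1_lt0 pi (x : R) : (x < 0)%R -> cdf1 pi x = 0%R.
Proof.
move=> x0; rewrite /cdf1 (_ : pi _ = 0)//.
apply/eqP; rewrite eq_le measure_ge0 andbT.
rewrite -(fmeas_conc pi) le_measure ?inE//.
  by apply: measurableC; exact: measurable_I01.
move=> t; rewrite /I01 /= !in_itv/= => tx /andP[+ _].
by rewrite leNgt (le_lt_trans tx).
Qed.

Lemma cdf1_ge1 pi (x : R) : (1 <= x)%R -> (cdf1 pi x)%:E = pi (@I01 R).
Proof.
move=> x1; rewrite -cdf1E -(fmeasI pi measurable_I01) //.
congr (pi _); apply/setIidr => t; rewrite /I01 /= !in_itv/= => /andP[_ t1].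
exact: le_trans x1.
Qed.

End sub_lebesgue.

(** * The nondecreasing coupling from quantile functions *)

Section finite_pushforward.
Local Open Scope ereal_scope.
Context d1 d2 (T1 : measurableType d1) (T2 : measurableType d2) (R : realType).
Variables (m : {finite_measure set T1 -> \bar R}) (f : T1 -> T2).
Hypothesis mf : measurable_fun setT f.

(** Carrying the measurability of [f] in the term lets the measure structure of
    the pushforward be inferred. *)
Definition fpushforward of measurable_fun setT f := pushforward m f.

Local Notation mu := (fpushforward mf).

Let mu0 : mu set0 = 0.
Proof. by rewrite /fpushforward /pushforward preimage_set0 measure0. Qed.

Let mu_ge0 A : 0 <= mu A. Proof. exact: measure_ge0. Qed.

Let mu_sigma_additive : semi_sigma_additive mu.
Proof. exact: (@measure_semi_sigma_additive _ _ _ (pushforward m f)). Qed.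

HB.instance Definition _ := isMeasure.Build _ _ _ mu
  mu0 mu_ge0 mu_sigma_additive.

Let mu_fin : fin_num_fun mu.
Proof.
move=> A mA; apply: fin_num_measure; rewrite -[X in measurable X]setTI; exact: mf.
Qed.

HB.instance Definition _ := Measure_isFinite.Build _ _ _ mu mu_fin.

End finite_pushforward.

Section quantile.
Context (R : realType).
Implicit Types (pi mu nu : M01 R) (u x : R).

Definition mass pi : R := fine (pi (@I01 R)).

Lemma massE pi : pi (@I01 R) = (mass pi)%:E.
Proof. by rewrite fineK// fmeas_fin//; exact: measurable_I01. Qed.

Lemma cdf1_mass pi x : cdf1 pi x <= mass pi.
Proof.
rewrite -lee_fin -cdf1E -massE fmeas_I01 le_measure ?inE//.
Qed.

Lemma cdf1_ge0 pi x : 0 <= cdf1 pi x.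
Proof. by rewrite -lee_fin -cdf1E. Qed.

Lemma mass_le1 pi : le_leb pi -> mass pi <= 1.
Proof.
move=> le_pi; rewrite -lee_fin -massE (le_trans (le_pi _ _ _))//.
  exact: measurable_I01.
by rewrite lebesgue_I01.
Qed.

(** The point [1] and the bounds [0 <= x <= 1] keep the infimum in [[0, 1]] for
    every real [u], so that [quantile pi] is nondecreasing, hence measurable, on
    the whole line. Inside [(0, mass pi]] this is the usual quantile function
    of [pi], without normalization of the mass: see [quantile_leE]. *)
Definition quantile_set pi u : set R :=
  [set x | x = 1 \/ 0 <= x <= 1 /\ u <= cdf1 pi x].

Definition quantile pi u : R := inf (quantile_set pi u).

Lemma quantile_set_ge0 pi u : lbound (quantile_set pi u) 0.
Proof. by move=> x /= [->|[/andP[]]]. Qed.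

Lemma quantile_ge0 pi u : 0 <= quantile pi u.
Proof.
by apply: lb_le_inf; [exists 1; left|exact: quantile_set_ge0].
Qed.

Lemma quantile_lb pi u x : quantile_set pi u x -> quantile pi u <= x.
Proof. by apply: ge_inf; exists 0; exact: quantile_set_ge0. Qed.

Lemma quantile_le1 pi u : quantile pi u <= 1.
Proof. by apply: quantile_lb; left. Qed.

Lemma quantile_nondecreasing pi : nondecreasing_fun (quantile pi).
Proof.
move=> u v uv; apply: lb_le_inf; first by exists 1; left.
move=> x [->|[x01 vx]]; first exact: quantile_le1.
by apply: quantile_lb; right; rewrite (le_trans uv).
Qed.

(** The Galois connection of quantiles and distribution functions. If
    [cdf1 pi x < u], then by the Lipschitz bound every point of [quantile_set]
    below [1] exceeds [x] by at least [u - cdf1 pi x]. *)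
Lemma quantile_leE pi u x : le_leb pi -> 0 < u -> u <= mass pi ->
  (quantile pi u <= x) = (u <= cdf1 pi x).
Proof.
move=> le_pi u0 uM; apply/idP/idP; last first.
  move=> ux; have [x0|x0] := ltP x 0; first by rewrite leNgt cdf1_lt0// u0 in ux.
  have [x1|x1] := leP 1 x; first exact: le_trans (quantile_le1 _ _) x1.
  by apply: quantile_lb; right; rewrite x0 ltW.
rewrite !leNgt; apply: contra => ux.
have [x1|x1] := leP 1 x.
  by move: ux; rewrite ltNge -lee_fin cdf1_ge1// massE lee_fin uM.
apply: (@lt_le_trans _ _ (Num.min 1 (x + (u - cdf1 pi x)))).
  by rewrite lt_min x1 ltrDl subr_gt0.
apply: lb_le_inf; first by exists 1; left.
move=> y [->|[y01 uy]]; first by rewrite ge_min lexx.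
rewrite ge_min; apply/orP; right.
have [yx|xy] := leP y x.
  by move: ux; rewrite ltNge (le_trans uy)// cdf1_le.
have := cdf1_lip le_pi (ltW xy); lra.
Qed.

Lemma measurable_quantile pi : measurable_fun [set: R] (quantile pi).
Proof. by apply: nondecreasing_measurable => //; exact: quantile_nondecreasing. Qed.

Section coupling.
Variables (mu nu : M01 R).
Hypotheses (le_mu : le_leb mu) (le_nu : le_leb nu).
Hypothesis munu : mu (@I01 R) = nu (@I01 R).
Local Open Scope ereal_scope.

Let massmunu : mass nu = mass mu. Proof. by rewrite /mass munu. Qed.

Let base : {finite_measure set R -> \bar R} :=
  mrestr (@leb01 R) (measurable_itv `]0%R, mass mu]).

Definition quantile2 u := (quantile mu u, quantile nu u).

Lemma measurable_quantile2 : measurable_fun [set: R] quantile2.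
Proof.
by apply: measurable_fun_pair; exact: measurable_quantile.
Qed.

Let g : {finite_measure set (R * R)%type -> \bar R} :=
  fpushforward base measurable_quantile2.

(** By [quantile_leE], the preimage of [(-oo, x]] in [(0, mass mu]] is
    [(0, cdf1 pi x]]. *)
Let base_marginal pi (q := quantile pi) : le_leb pi -> mass pi = mass mu ->
  forall A, measurable A -> base (q @^-1` A) = pi A.
Proof.
move=> le_pi mpi A mA.
apply: (@measure_eq_cdf _ (fpushforward base (measurable_quantile pi)) pi) => //.
  by move=> x; rewrite ltey_eq fin_num_measure.
move=> x; rewrite [RHS]cdf1E /= /fpushforward /pushforward /= /mrestr.
rewrite (_ : _ `&` _ = `]0%R, cdf1 pi x]%classic).
  rewrite leb01_itv ?subr0// ?cdf1_ge0//.
  by rewrite (le_trans (cdf1_mass _ _))// mass_le1.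
apply/seteqP; split=> u /=; rewrite !in_itv/=.
  by case=> qx /andP[u0 uM]; rewrite u0 -quantile_leE// mpi.
move=> /andP[u0 ux].
have uM : (u <= mass pi)%R by rewrite (le_trans ux)// cdf1_mass.
by rewrite quantile_leE// u0 -mpi.
Qed.

Let g_conc : g (~` @I01sq R) = 0.
Proof.
rewrite /g /= /fpushforward /pushforward (_ : _ @^-1` _ = set0) ?measure0//.
apply/seteqP; split=> // u; apply; rewrite /I01sq /I01 /=.
by rewrite !in_itv/= !quantile_ge0 !quantile_le1.
Qed.

(** The two quadrants pull back to [cdf1 nu b < u <= cdf1 mu a] and to
    [cdf1 mu a < u <= cdf1 nu b]. *)
Let g_comonotone : comonotone g.
Proof.
move=> a b; rewrite /g /= /fpushforward /pushforward /= /mrestr.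
have null (A : set R) : (forall u, ~ A u) -> leb01 A = 0.
  by move=> A0; rewrite (_ : A = set0) ?measure0//; apply/seteqP; split.
have [ab|/ltW ba] := leP (cdf1 mu a) (cdf1 nu b); [left|right]; apply: null => u;
    rewrite /preimage /= ?NWE ?SEE in_itv/= => -[/andP[]].
  rewrite /quantile2 /= => qa + /andP[u0 uM]; move: qa.
  rewrite ltNge !quantile_leE ?massmunu// => ua /negP; apply.
  exact: le_trans ab.
rewrite /quantile2 /= => + qb /andP[u0 uM]; move: qb.
rewrite ltNge !quantile_leE ?massmunu// => ub /negP; apply.
exact: le_trans ba.
Qed.

Lemma nd_coupling_exists : exists gamma : M01sq R, is_nd_coupling mu nu gamma.
Proof.
exists (FMeas g_conc); split.
- by move=> A mA; exact: (base_marginal le_mu).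
- by move=> A mA; exact: (base_marginal le_nu).
- exact/nondecreasing_comonotone/g_comonotone.
Qed.

Lemma nd_couplingP : is_nd_coupling mu nu (nd_coupling mu nu).
Proof.
exact: (@xgetPex _ (fmeas0 R (@I01sq R) : M01sq R)
  [set gamma : M01sq R | is_nd_coupling mu nu gamma] nd_coupling_exists).
Qed.

Lemma nd_coupling_marginals : has_marginals mu nu (nd_coupling mu nu).
Proof. by have [] := nd_couplingP. Qed.

Lemma nd_coupling_comonotone : comonotone (nd_coupling mu nu).
Proof. by have [_ _ /nondecreasing_comonotone] := nd_couplingP. Qed.

Lemma nd_coupling_unique (gamma : M01sq R) :
  has_marginals mu nu gamma -> comonotone gamma ->
  eq_meas (nd_coupling mu nu) gamma.
Proof.
move=> gm gco; apply: measure_eq_SW => a b.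
rewrite (comonotone_SW _ _ gm gco).
exact: comonotone_SW nd_coupling_marginals nd_coupling_comonotone.
Qed.

End coupling.
End quantile.

(** * The pattern 321 through boxes *)

Section pattern321.
Context (R : realType).
Implicit Types (a b : R) (mu : M01sq R).

Definition MID a1 a2 b1 b2 : set (R * R) :=
  `]a1, a2]%classic `*` `]b1, b2]%classic.

Lemma MIDE a1 a2 b1 b2 p :
  MID a1 a2 b1 b2 p = ((a1 < p.1 <= a2) && (b1 < p.2 <= b2)) :> Prop.
Proof.
apply/propext; rewrite /MID /setX /= !in_itv/=.
by split=> [[-> ->]|/andP[-> ->]].
Qed.

Lemma measurable_MID a1 a2 b1 b2 : measurable (MID a1 a2 b1 b2).
Proof. exact: measurableX. Qed.

(** The corners [(a1, b2)] and [(a2, b1)] separate the first point of a 321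
    pattern from the second one, and the second one from the third one. *)
Definition box321 a1 a2 b1 b2 : set ((R * R) * (R * R) * (R * R)) :=
  NW a1 b2 `*` MID a1 a2 b1 b2 `*` SE a2 b1.

Lemma box321_sub a1 a2 b1 b2 : box321 a1 a2 b1 b2 `<=` @pattern321 R.
Proof.
move=> [[p q] r] [[/=]]; rewrite NWE MIDE SEE.
move=> /andP[pa bp] /andP[/andP[aq qa] /andP[bq qb]] /andP[ar rb].
by rewrite (le_lt_trans pa aq) (le_lt_trans qa ar) (le_lt_trans rb bq)
  (le_lt_trans qb bp).
Qed.

Lemma measurable_box321 a1 a2 b1 b2 : measurable (box321 a1 a2 b1 b2).
Proof.
apply: measurableX => //; apply: measurableX => //; exact: measurable_MID.
Qed.

Lemma pattern321_bigcup : @pattern321 R = \bigcup_n let q := rat4 n in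
  box321 (ratr q.1.1) (ratr q.1.2) (ratr q.2.1) (ratr q.2.2).
Proof.
apply/seteqP; split; last by move=> t [n _]; exact: box321_sub.
move=> [[p q] r] /= /andP[/andP[pq1 qr1] /andP[rq2 qp2]].
have [a1 /andP[pa aq]] := rat_between pq1.
have [a2 /andP[qa ar]] := rat_between qr1.
have [b1 /andP[rb bq]] := rat_between rq2.
have [b2 /andP[qb bp]] := rat_between qp2.
have [n nE] := rat4_surj (a1, a2, (b1, b2)); exists n => //=.
by rewrite nE /box321 /setX /= NWE MIDE SEE !ltW // aq bq bp ar.
Qed.

Local Open Scope ereal_scope.

Definition box321_avoiding (mu : set (R * R)%type -> \bar R) :=
  forall a1 a2 b1 b2 : R,
  [\/ mu (NW a1 b2) = 0, mu (MID a1 a2 b1 b2) = 0 | mu (SE a2 b1) = 0].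

Lemma pattern321_null mu :
  ((mu \x mu) \x mu) (@pattern321 R) = 0 <-> box321_avoiding mu.
Proof.
have boxE a1 a2 b1 b2 : ((mu \x mu) \x mu) (box321 a1 a2 b1 b2) =
    mu (NW a1 b2) * mu (MID a1 a2 b1 b2) * mu (SE a2 b1).
  rewrite /box321 product_measure1E//; last first.
    by apply: measurableX => //; exact: measurable_MID.
  congr (_ * _); apply: product_measure1E => //; exact: measurable_MID.
have m321 : measurable (@pattern321 R).
  rewrite pattern321_bigcup; apply: bigcupT_measurable => n.
  exact: measurable_box321.
split=> [mu321 a1 a2 b1 b2|av].
  have : ((mu \x mu) \x mu) (box321 a1 a2 b1 b2) = 0.
    apply/eqP; rewrite eq_le measure_ge0 andbT -mu321 le_measure ?inE//.
      exact: measurable_box321.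
    exact: box321_sub.
  rewrite boxE => /eqP; rewrite !mule_eq0.
  by move=> /orP[/orP[]|] /eqP; [constructor 1|constructor 2|constructor 3].
apply/(@negligibleP _ _ _ ((mu \x mu) \x mu)) => //.
rewrite pattern321_bigcup; apply: negligible_bigcup => n.
apply/negligibleP; first exact: measurable_box321.
rewrite /= boxE.
by have [->|->|->] := av (ratr (rat4 n).1.1) (ratr (rat4 n).1.2)
  (ratr (rat4 n).2.1) (ratr (rat4 n).2.2); rewrite ?(mule0, mul0e).
Qed.

(** Any two of the three rectangles of a box lie in opposite quadrants of a
    common corner, so a comonotone measure charges at most one of the three. *)
Lemma comonotone_add_avoiding (g1 g2 : {measure set (R * R)%type -> \bar R}) :
  comonotone g1 -> comonotone g2 -> box321_avoiding (measure_add g1 g2).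
Proof.
move=> g1co g2co a1 a2 b1 b2; rewrite !measure_addE.
have mMID := measurable_MID a1 a2 b1 b2.
have [MID0|/set0P[p]] := eqVneq (MID a1 a2 b1 b2) set0.
  by constructor 2; rewrite MID0 !measure0 adde0.
rewrite MIDE => /andP[/andP[ap pa] /andP[bp pb]].
have a12 := lt_le_trans ap pa; have b12 := lt_le_trans bp pb.
have two (g : {measure set (R * R)%type -> \bar R}) : comonotone g ->
    [\/ g (NW a1 b2) = 0 /\ g (MID a1 a2 b1 b2) = 0,
      g (MID a1 a2 b1 b2) = 0 /\ g (SE a2 b1) = 0 |
      g (SE a2 b1) = 0 /\ g (NW a1 b2) = 0].
  move=> gco; have [NW0|SE0] := gco a1 b2.
    have [MID0|SE0] := gco a2 b1; last by constructor 3.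
    constructor 1; split=> //; apply: null_sub MID0 => // q.
    by rewrite MIDE NWE => /andP[/andP[_ ->] /andP[->]].
  constructor 2; split; apply: null_sub SE0 => // q.
    by rewrite MIDE SEE => /andP[/andP[-> _] /andP[_ ->]].
  rewrite !SEE => /andP[aq qb].
  by rewrite (lt_trans a12 aq) (le_trans qb (ltW b12)).
by have [[-> ->]|[-> ->]|[-> ->]] := two g1 g1co;
  have [[-> ->]|[-> ->]|[-> ->]] := two g2 g2co;
  [constructor 1|constructor 2|constructor 1|constructor 2|constructor 2|
   constructor 3|constructor 1|constructor 3|constructor 3]; rewrite adde0.
Qed.

End pattern321.

(** * The values of [Psi] *)

Section Psi_permuton.
Context (R : realType).
Local Open Scope ereal_scope.

Lemma leb_sub_mass (pi1 pi2 : M01 R) : le_leb pi1 -> le_leb pi2 ->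
  pi1 (@I01 R) = pi2 (@I01 R) -> leb_sub pi1 (@I01 R) = leb_sub pi2 (@I01 R).
Proof.
have mI := @measurable_I01 R.
by move=> le1 le2 E; rewrite !leb_subE// E.
Qed.

Section on_D.
Variable (p : M01 R * M01 R).
Hypothesis Dp : calD p.

Let le1 : le_leb p.1. Proof. by have [] := Dp. Qed.
Let le2 : le_leb p.2. Proof. by have [] := Dp. Qed.
Let mass12 : p.1 (@I01 R) = p.2 (@I01 R). Proof. by have [] := Dp. Qed.
Let lowerP := nd_coupling_marginals le1 le2 mass12.
Let upperP := nd_coupling_marginals (le_leb_sub le1) (le_leb_sub le2)
  (leb_sub_mass le1 le2 mass12).

Lemma Psi_marginals : has_marginals (@leb01 R) (@leb01 R) (Psi p).
Proof.
have [l1 l2] := lowerP; have [u1 u2] := upperP.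
split=> A mA; rewrite /pushforward /Psi /= measure_addE.
  rewrite [X in X + _](l1 _ mA) [X in _ + X](u1 _ mA) leb_subE//.
  by rewrite addeC subeK// fmeas_fin.
rewrite [X in X + _](l2 _ mA) [X in _ + X](u2 _ mA) leb_subE//.
by rewrite addeC subeK// fmeas_fin.
Qed.

Lemma Psi_permuton321 : permuton321 (Psi p).
Proof.
have [P1 P2] := Psi_marginals; split; last first.
  apply/pattern321_null; apply: comonotone_add_avoiding.
    exact: nd_coupling_comonotone.
  apply: nd_coupling_comonotone; try exact: le_leb_sub.
  exact: leb_sub_mass.
split => //.
transitivity (pushforward (Psi p) fst setT).
  rewrite /pushforward preimage_setT.
  by rewrite -(fmeasI (Psi p) (@measurable_I01sq R) measurableT) setTI.
by rewrite P1// /leb01 setTI lebesgue_I01.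
Qed.

Lemma Psi_SW a b : Psi p (SW a b) =
  (Num.min (cdf1 p.1 a) (cdf1 p.2 b) +
   Num.min (cdf1 (leb_sub p.1) a) (cdf1 (leb_sub p.2) b))%:E.
Proof.
rewrite /Psi /= measure_addE EFinD !EFin_min -!cdf1E; congr (_ + _).
  apply: comonotone_SW lowerP _; exact: nd_coupling_comonotone.
apply: comonotone_SW upperP _; apply: nd_coupling_comonotone.
- exact: le_leb_sub.
- exact: le_leb_sub.
- exact: leb_sub_mass.
Qed.

End on_D.
End Psi_permuton.

(** * Surjectivity: cutting a permuton along the diagonal *)

Section crossing.
Context (R : realType).
Local Open Scope ereal_scope.
Implicit Types (mu : {finite_measure set (R * R)%type -> \bar R}) (a b s t : R).

Definition above : set (R * R) := [set p | (p.1 <= p.2)%R].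

Lemma measurable_above : measurable above.
Proof.
rewrite -[X in measurable X]setTI.
apply: (@measurable_fun_le _ _ R setT fst snd) => //.
Qed.

(** Equal marginals: as much mass crosses the diagonal point [(s, s)] on its
    upper left as on its lower right. *)
Lemma NW_diag_eq_SE mu s : has_marginals (@leb01 R) (@leb01 R) mu ->
  mu (NW s s) = mu (SE s s).
Proof.
move=> [m1 m2].
have E1 := measure_fst_ray mu s s; rewrite [LHS]m1// in E1.
have E2 := measure_snd_ray mu s s; rewrite [LHS]m2// E1 in E2.
move/(congr1 (fun x => x - mu (SW s s))) : E2.
by rewrite !(addeC (mu (SW s s))) !addeK ?fin_num_measure.
Qed.

(** Lowering the corner of [SE t t] to height [s] loses at most the mass
    [t - s] of the strip [s < y <= t]. *)
Lemma SE_offdiag_gt0 mu a b s t : has_marginals (@leb01 R) (@leb01 R) mu ->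
  (a <= t)%R -> (t <= b)%R -> (s <= t)%R -> (t - s)%:E < mu (NW a b) -> 0 < mu (SE t s).
Proof.
move=> mm a_t tb st small.
have mS : measurable (setT `*` `]s, t]%classic : set (R * R)).
  exact: measurableX.
have strip : mu (setT `*` `]s, t]%classic) <= (t - s)%:E.
  have -> : setT `*` `]s, t]%classic = snd @^-1` `]s, t]%classic :> set (R * R).
    by apply/seteqP; split=> x; rewrite /preimage /setX /=; tauto.
  by have [_ m2] := mm; rewrite [leLHS]m2// leb01_itv_le.
rewrite ltNge; apply/negP => SE0.
move: small; apply/negP; rewrite -leNgt.
apply: (@le_trans _ _ (mu (NW t t))).
  rewrite le_measure ?inE// => p; rewrite !NWE => /andP[pa bp].
  by rewrite (le_trans pa)// (le_lt_trans tb).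
rewrite (NW_diag_eq_SE t mm).
apply: (@le_trans _ _ (mu (SE t s `|` (setT `*` `]s, t]%classic)))).
  rewrite le_measure ?inE//; first exact: measurableU.
  move=> p; rewrite SEE /= SEE in_itv /= => /andP[-> pt].
  by case: (leP p.2 s) => ps; [left|right; rewrite pt].
rewrite (le_trans (measureU2 _ _ _))//.
by rewrite -[leRHS]add0e leeD.
Qed.

(** Vertical slices of [SE a b] of width [h] smaller than the mass of [NW a b]
    are shown to be null one after the other, as the middle rectangle of a box
    whose other two rectangles are not null. *)
Lemma above_comonotone mu a b : has_marginals (@leb01 R) (@leb01 R) mu ->
  box321_avoiding mu -> mu (NW a b) = 0 \/ mu (SE a b `&` above) = 0.
Proof.
move=> mm av; have [->|NW0] := eqVneq (mu (NW a b)) 0; [by left|right].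
have mA := measurable_above.
have [ba|ab] := leP b a.
  rewrite (_ : _ `&` _ = set0) ?measure0//; apply/seteqP; split=> // p [].
  by rewrite SEE /above /= => /andP[? ?] ?; lra.
set d := fine (mu (NW a b)).
have dE : mu (NW a b) = d%:E by rewrite fineK// fin_num_measure.
have d0 : (0 < d)%R by rewrite -lte_fin -dE lt0e NW0 measure_ge0.
pose N := (Num.truncn ((b - a) / d)).+1.
pose h := ((b - a) / N%:R)%R.
have h0 : (0 < h)%R by rewrite divr_gt0 ?subr_gt0// ltr0n.
have hd : (h < d)%R.
  by rewrite /h ltr_pdivrMr ?ltr0n// mulrC -ltr_pdivrMr// truncnS_gt.
(* [N] slices of width [h] fill [(a, b]], and [h < d]. *)
pose s i := (a + h * i%:R)%R.
have mB x : measurable (SE a b `&` above `&` `]-oo, x]%classic `*` setT).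
  by apply: measurableI; [exact: measurableI|exact: measurableX].
have slice i : (i <= N)%N -> mu (SE a b `&` above `&` `]-oo, s i]%classic `*` setT) = 0.
  elim: i => [_|i IH iN].
    rewrite (_ : _ `&` _ = set0) ?measure0//; apply/seteqP; split=> // p [[]].
    by rewrite SEE /s mulr0 addr0 => /andP[ap _] _ [/=]; rewrite in_itv/= leNgt ap.
  have as_ : (a <= s i)%R by rewrite /s lerDl mulr_ge0// ltW.
  have sS : s i.+1 = (s i + h)%R by rewrite /s; rewrite -natr1; lra.
  have sb : (s i.+1 <= b)%R.
    rewrite /s /h -lerBrDl mulrAC ler_pdivrMr ?ltr0n// ler_wpM2l ?ler_nat//.
    by rewrite subr_ge0 ltW.
  apply: (null_sub _ _ (B := (SE a b `&` above `&` `]-oo, s i]%classic `*` setT)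
    `|` MID (s i) (s i.+1) (s i) b)) => //.
  - by apply: measurableU => //; exact: measurable_MID.
  - move=> p [[Bp pa]] [/=]; rewrite in_itv/= => ps _.
    have [psi|psi] := leP p.1 (s i); [left|right]; first by split.
    move: Bp pa; rewrite MIDE SEE /above /= => /andP[_ pb] p12.
    by rewrite psi ps pb (lt_le_trans psi).
  apply/eqP; rewrite eq_le measure_ge0 andbT (le_trans (measureU2 _ _ _))//.
    exact: measurable_MID.
  rewrite [X in X + _](IH (ltnW iN)) add0e.
  (* Above the diagonal, the slice [s i < x <= s i.+1] also has [s i < y]. *)
  have [P0|M0|R0] := av (s i) (s i.+1) (s i) b; last 2 first.
  - by rewrite [leLHS]M0.
  - have : 0 < mu (SE (s i.+1) (s i)).
    apply: (@SE_offdiag_gt0 _ a b) => //; rewrite sS.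
    + by rewrite (le_trans as_)// lerDl ltW.
    + by rewrite lerDl ltW.
    + by rewrite dE lte_fin; lra.
    by rewrite R0 ltxx.
  move/eqP: NW0 => []; apply: null_sub P0 => // p.
  by rewrite !NWE => /andP[pa ->]; rewrite (le_trans pa).
apply: null_sub (slice N (leqnn N)) => //; first exact: measurableI.
move=> p [Bp pa]; split=> //; split=> //=; rewrite in_itv/=.
have -> : s N = b by rewrite /s /h divfK ?pnatr_eq0//; lra.
by move: Bp pa; rewrite SEE /above /= => /andP[_ pb] /le_trans; apply.
Qed.

Let swapf (p : R * R) := (p.2, p.1).

Let mswap : measurable_fun [set: R * R] swapf.
Proof. exact: measurable_fun_pair. Qed.

(** Exchanging the coordinates preserves the pattern 321: it reverses the order
    of the three points and exchanges the two quadrants of a corner. *)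
Lemma below_comonotone mu a b : has_marginals (@leb01 R) (@leb01 R) mu ->
  box321_avoiding mu ->
  mu (SE a b) = 0 \/ mu (NW a b `&` [set p | (p.2 <= p.1)%R]) = 0.
Proof.
move=> [m1 m2] av.
pose nu : {finite_measure set (R * R)%type -> \bar R} := fpushforward mu mswap.
have nuE A : nu A = mu (swapf @^-1` A) by [].
have swapNW x y : swapf @^-1` NW x y = SE y x.
  by apply/funext => p; rewrite /preimage /= NWE SEE andbC.
have swapSE x y : swapf @^-1` SE x y = NW y x.
  by apply/funext => p; rewrite /preimage /= NWE SEE andbC.
have [] := @above_comonotone nu b a.
- by split=> A mA; [exact: m2|exact: m1].
- move=> a1 a2 b1 b2; rewrite !nuE swapNW swapSE.
  have -> : swapf @^-1` MID a1 a2 b1 b2 = MID b1 b2 a1 a2.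
    by apply/funext => p; rewrite /preimage /= !MIDE andbC.
  by have [->|->|->] := av b1 b2 a1 a2; [constructor 3|constructor 2|constructor 1].
- by rewrite nuE swapNW; left.
by rewrite nuE preimage_setI swapSE; right.
Qed.

End crossing.

Section surjectivity.
Context (R : realType).
Local Open Scope ereal_scope.
Variable mu : M01sq R.
Hypothesis permu : permuton321 mu.

Let mm : has_marginals (@leb01 R) (@leb01 R) mu.
Proof. by have [[]] := permu. Qed.

Let av : box321_avoiding mu.
Proof. by have [_ /pattern321_null] := permu. Qed.

Let below : set (R * R) := [set p | (p.2 <= p.1)%R].

Let mbelow : measurable below.
Proof.
rewrite -[X in measurable X]setTI; exact: (@measurable_fun_le _ _ R setT snd fst).
Qed.

Let mI := @measurable_I01 R.
Let mIsq := @measurable_I01sq R.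

Let restr_conc (D : set (R * R)) (mD : measurable D) : mrestr mu mD (~` @I01sq R) = 0.
Proof.
apply: null_sub (fmeas_conc mu) => //; last exact: measurableC.
by apply: measurableI => //; exact: measurableC.
Qed.

Let lower : M01sq R := @FMeas _ _ R (@I01sq R) (mrestr mu mbelow) (restr_conc mbelow).
Let upper : M01sq R := @FMeas _ _ R (@I01sq R)
  (mrestr mu (measurableC mbelow)) (restr_conc (measurableC mbelow)).

Let fst_conc : fpushforward lower (@measurable_fst _ _ R R) (~` @I01 R) = 0.
Proof.
apply: null_sub (fmeas_conc lower); last by move=> p /= np [].
  by rewrite -[X in measurable X]setTI; apply: measurable_fst => //; exact: measurableC.
exact: measurableC.
Qed.

Let snd_conc : fpushforward lower (@measurable_snd _ _ R R) (~` @I01 R) = 0.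
Proof.
apply: null_sub (fmeas_conc lower); last by move=> p /= np [].
  by rewrite -[X in measurable X]setTI; apply: measurable_snd => //; exact: measurableC.
exact: measurableC.
Qed.

Let pi1 : M01 R := FMeas fst_conc.
Let pi2 : M01 R := FMeas snd_conc.


Let lowerE A : lower A = mu (A `&` below). Proof. by []. Qed.
Let upperE A : upper A = mu (A `&` ~` below). Proof. by []. Qed.

Let mfst (A : set R) : measurable A -> measurable (fst @^-1` A : set (R * R)).
Proof. by move=> mA; rewrite -[X in measurable X]setTI; exact: measurable_fst. Qed.

Let msnd (A : set R) : measurable A -> measurable (snd @^-1` A : set (R * R)).
Proof. by move=> mA; rewrite -[X in measurable X]setTI; exact: measurable_snd. Qed.

Let lower_marginals : has_marginals pi1 pi2 lower.
Proof. by []. Qed.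

Let lower_le A : measurable A -> lower A <= mu A.
Proof.
move=> mA; rewrite lowerE; apply: le_measure; rewrite ?inE//.
exact: measurableI.
Qed.

Let le_pi1 : le_leb pi1.
Proof.
move=> A mA AI; rewrite -(setIidl AI) -[leRHS]/(leb01 A) -(mm.1 _ mA) (setIidl AI).
by apply: lower_le; exact: mfst.
Qed.

Let le_pi2 : le_leb pi2.
Proof.
move=> A mA AI; rewrite -(setIidl AI) -[leRHS]/(leb01 A) -(mm.2 _ mA) (setIidl AI).
by apply: lower_le; exact: msnd.
Qed.

Let mass12 : pi1 (@I01 R) = pi2 (@I01 R).
Proof. by rewrite !fmeas_I01. Qed.

Let split_mu A : measurable A -> mu A = lower A + upper A.
Proof.
by move=> mA; rewrite lowerE upperE -setDE addeC -(measureDI mu mA mbelow).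
Qed.

Let upper_marginals : has_marginals (leb_sub pi1) (leb_sub pi2) upper.
Proof.
split=> A mA; rewrite leb_subE//.
  rewrite -(mm.1 _ mA) /pushforward (split_mu (mfst mA)) [X in X - _]addeC addeK//.
  by apply: fmeas_fin; exact: mfst.
rewrite -(mm.2 _ mA) /pushforward (split_mu (msnd mA)) [X in X - _]addeC addeK//.
by apply: fmeas_fin; exact: msnd.
Qed.

Let lower_comonotone : comonotone lower.
Proof.
move=> a b; have [S0|N0] := below_comonotone a b mm av; [right|by left].
apply: null_sub S0 => //.
exact: measurableI.
Qed.

Let upper_comonotone : comonotone upper.
Proof.
move=> a b; have [N0|S0] := above_comonotone a b mm av; [left|right].
  apply: null_sub N0 => //.
  by apply: measurableI => //; exact: measurableC.
apply: null_sub S0 => //.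
- by apply: measurableI => //; exact: measurableC.
- by apply: measurableI => //; exact: measurable_above.
by move=> p [Sp /negP]; rewrite /above /= -ltNge => /ltW.
Qed.

(** On [y <= x], a first coordinate at most [t] forces the second one to be at
    most [t]. *)
Let calD_pi : calD (pi1, pi2).
Proof.
split=> //= x _; rewrite -(fmeasI lower mIsq) /pushforward; last first.
  by apply: mfst; exact: measurable_itv.
apply: (@le_trans _ _ (mu ((snd @^-1` `[0%R, x]%classic) `&` below))); last by [].
rewrite lowerE le_measure ?inE//.
- apply: measurableI => //; apply: measurableI => //.
  by apply: mfst; exact: measurable_itv.
- by apply: measurableI => //; apply: msnd; exact: measurable_itv.
move=> p [[px p01] pb]; move: px p01; rewrite /I01sq /I01 /setX /= !in_itv/=.
move=> /andP[_ px] [_ /andP[p0 _]]; split=> //; rewrite p0 /=.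
exact: le_trans px.
Qed.

Lemma Psi_surjective : exists2 p : M01 R * M01 R, calD p & eq_meas (Psi p) mu.
Proof.
exists (pi1, pi2) => // A mA; rewrite (split_mu mA) /Psi /= measure_addE.
congr (_ + _).
  exact: (nd_coupling_unique le_pi1 le_pi2 mass12 lower_marginals).
exact: (nd_coupling_unique (le_leb_sub le_pi1) (le_leb_sub le_pi2)
  (leb_sub_mass le_pi1 le_pi2 mass12) upper_marginals).
Qed.

End surjectivity.

(** * Weak continuity of distribution functions *)

Section weak_topology.
Context (R : realType).

Lemma M01_int_continuous (f : C01 R) : continuous (@M01_int R ^~ f).
Proof.
move=> mu.
apply: (@continuous_comp _ _ _ (@M01_int R) (fun g => g f)).
  exact: initial_continuous.
exact: (@proj_continuous (C01 R) (fun=> R) f).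
Qed.

Lemma within_continuous_M01sq {X : topologicalType} (A : set X) (F : X -> M01sq R) :
  (forall (f : C01sq R) x, A x ->
    M01sq_int (F y) f @[y --> within A (nbhs x)] --> M01sq_int (F x) f) ->
  {within A, continuous F}.
Proof.
move=> cF; apply: (@continuous_comp_initial (M01sq R) (subspace A)
  {ptws C01sq R -> R} (@M01sq_int R) F).
apply/subspace_continuousP => x Ax.
apply/cvg_sup => f U [_ [[/= W oW <-]] Wx /filterS]; apply.
by apply: (cF f x Ax); exact: open_nbhs_nbhs.
Qed.

Definition ramp (x e t : R) : R := Num.max 0 (Num.min 1 ((x + e - t) / e)).

Lemma continuous_ramp x e : continuous (ramp x e).
Proof.
move=> t; apply: (@continuous_max _ _ (cst 0) _ t); first exact: cvg_cst.
apply: (@continuous_min _ _ (cst 1) _ t); first exact: cvg_cst.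
apply: (@cvgMl _ _ _ _ (fun t => x + e - t)).
by apply: cvgB; [exact: cvg_cst|exact: cvg_id].
Qed.

Definition rampC x e : C01 R :=
  exist _ (ramp x e) (continuous_subspaceT (@continuous_ramp x e)).

Lemma ramp_ge0 x e t : 0 <= ramp x e t.
Proof. by rewrite le_max lexx. Qed.

Lemma ramp_le1 x e t : ramp x e t <= 1.
Proof. by rewrite ge_max ler01 ge_min lexx. Qed.

Lemma ramp_eq1 x e t : 0 < e -> t <= x -> ramp x e t = 1.
Proof.
move=> e0 tx; rewrite /ramp min_l ?max_r//.
by rewrite ler_pdivlMr// mul1r; lra.
Qed.

Lemma ramp_eq0 x e t : 0 < e -> x + e < t -> ramp x e t = 0.
Proof.
move=> e0 tx; rewrite /ramp max_l// ge_min; apply/orP; right.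
by rewrite ler_pdivrMr// mul0r; lra.
Qed.

(** The ramp equals [1] up to [x] and [0] from [x + e] on. Its integral differs
    from the distribution function by at most [e], whatever the measure [pi]
    below Lebesgue measure. *)
Lemma cdf1_ramp (pi : M01 R) x e : le_leb pi -> 0 < e ->
  cdf1 pi x <= M01_int pi (rampC x e) <= cdf1 pi x + e.
Proof.
move=> le_pi e0; have mI := @measurable_I01 R.
have mr : measurable_fun (@I01 R) (fun t => (ramp x e t)%:E).
  apply/measurable_EFinP; apply: measurable_funTS.
  by apply: continuous_measurable_fun; exact: continuous_ramp.
have ray y : (\int[pi]_(t in @I01 R) (\1_`]-oo, y]%classic t)%:E = (cdf1 pi y)%:E)%E.
  by rewrite integral_indic// [LHS]fmeasI// cdf1E.
have mray y : measurable_fun (@I01 R) (fun t => (\1_`]-oo, y]%classic t)%:E : \bar R).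
  exact/measurable_EFinP.
have lo : ((cdf1 pi x)%:E <= \int[pi]_(t in @I01 R) (ramp x e t)%:E)%E.
  rewrite -ray; apply: ge0_le_integral => //.
  move=> t _; rewrite lee_fin indicE; case: (boolP (t \in _)); rewrite ?inE /=.
    by rewrite in_itv/= => /(ramp_eq1 e0) ->.
  by move=> _; exact: ramp_ge0.
have hi : (\int[pi]_(t in @I01 R) (ramp x e t)%:E <= (cdf1 pi (x + e))%:E)%E.
  rewrite -ray; apply: ge0_le_integral => //.
    by move=> t _; rewrite lee_fin ramp_ge0.
  move=> t _; rewrite lee_fin indicE; case: (boolP (t \in _)); rewrite ?inE /=.
    by move=> _; exact: ramp_le1.
  by rewrite notin_setE /= in_itv/= => /negP; rewrite -ltNge => /(ramp_eq0 e0) ->.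
have fn : (\int[pi]_(t in @I01 R) (ramp x e t)%:E)%E \is a fin_num.
  by rewrite fin_real// (lt_le_trans _ lo) ?ltNyr// (le_lt_trans hi)// ltry.
move: lo hi; rewrite -(fineK fn) !lee_fin => lo hi.
have xe : x <= x + e by rewrite lerDl ltW.
rewrite /M01_int /Rintegral /= lo (le_trans hi)//.
by have := cdf1_lip le_pi xe; lra.
Qed.

Lemma cdf1_cvg (T : Type) (F : set_system T) (FF : Filter F) (g : T -> M01 R)
    (pi : M01 R) x : le_leb pi -> (\forall t \near F, le_leb (g t)) ->
  g @ F --> pi -> cdf1 (g t) x @[t --> F] --> cdf1 pi x.
Proof.
move=> le_pi le_g gpi; apply/cvgrPdist_le => e e0.
have e3 : 0 < e / 3 by rewrite divr_gt0.
have cI : M01_int (g t) (rampC x (e / 3)) @[t --> F] --> M01_int pi (rampC x (e / 3)).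
  exact: (cvg_comp _ _ gpi (@M01_int_continuous (rampC x (e / 3)) pi)).
move/cvgrPdist_le : cI => /(_ _ e3) cI.
near=> t.
have := cdf1_ramp x le_pi e3.
have : le_leb (g t) by near: t.
move=> /(@cdf1_ramp _ x _) /(_ e3) /andP[? ?] /andP[? ?].
have : `|M01_int pi (rampC x (e / 3)) - M01_int (g t) (rampC x (e / 3))| <= e / 3.
  by near: t.
by rewrite !ler_norml => /andP[? ?]; apply/andP; split; lra.
Unshelve. all: by end_near. Qed.

End weak_topology.

(** * Approximation of test functions on a grid *)

Section test_functions.
Context (R : realType).
Implicit Types (f : C01sq R) (g : M01sq R).

Lemma compact_I01sq : compact (@I01sq R).
Proof. by apply: compact_setX; exact: segment_compact. Qed.

Lemma C01sq_measurable f : measurable_fun (@I01sq R) (sval f).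
Proof.
have mI := @measurable_I01sq R.
apply: (measurability _ (RGenOpens.measurableE R)).
move=> _ [_ [a [b ->] <-]].
have /continuousP cf := svalP f.
have /open_subspaceP[V oV VE] :
    open (sval f @^-1` `]a, b[ : set (subspace (@I01sq R))).
  exact/cf/interval_open.
by rewrite setIC -VE; apply: measurableI => //; exact: open_measurable2.
Qed.

Lemma C01sq_integrable f g : g.-integrable (@I01sq R) (EFin \o sval f).
Proof.
have mI := @measurable_I01sq R.
apply: measurable_bounded_integrable => //.
- by rewrite ltey_eq fmeas_fin.
- exact: C01sq_measurable.
have /compact_bounded[M [Mr fM]] : compact (sval f @` @I01sq R).
  by apply: continuous_compact; [exact: (svalP f)|exact: compact_I01sq].
exists M; split=> // x Mx p Ip /=; apply: fM => //; by exists p.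
Qed.

Definition oscillation_le f (h e : R) := forall p q, I01sq p -> I01sq q ->
  `|p.1 - q.1| <= h -> `|p.2 - q.2| <= h -> `|sval f p - sval f q| <= e.

(** Uniform continuity on the compact square. *)
Lemma C01sq_oscillation f e : 0 < e -> exists n : nat, oscillation_le f n.+1%:R^-1 e.
Proof.
move=> e0; have /compact_near_coveringP/near_covering_withinP cov := compact_I01sq.
have [] := cov nat \oo (fun n p => forall q, I01sq q ->
   `|p.1 - q.1| <= n.+1%:R^-1 -> `|p.2 - q.2| <= n.+1%:R^-1 ->
   `|sval f p - sval f q| <= e).
  move=> p Ip.
  have /subspace_continuousP/(_ p Ip)/cvgrPdist_lt/(_ (e / 2)) := svalP f.
  rewrite divr_gt0// => /(_ isT); rewrite near_withinE => /nbhs_ballP[r /= r0 fr].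
  have r2 : 0 < r / 2 by rewrite divr_gt0.
  exists (ball p (r / 2), [set n : nat | n.+1%:R^-1 <= r / 2]) => /=.
    split; first exact: nbhsx_ballx.
    near=> n; rewrite /= -[leRHS]invrK lef_pV2 ?posrE ?invr_gt0 ?ltr0n//.
    rewrite (@le_trans _ _ n%:R) ?ler_nat//; near: n; exact: nbhs_infty_ger.
  move=> [p' n] /= [[pp1 pp2] nr] Ip' q Iq.
  move: nr; set w := (n.+1%:R^-1 : R); move: w => w nr q1 q2.
  have fp' : `|sval f p - sval f p'| < e / 2.
    apply: fr => //; split; rewrite /ball /=.
      by rewrite (lt_trans pp1)//; lra.
    by rewrite (lt_trans pp2)//; lra.
  have fq : `|sval f p - sval f q| < e / 2.
    apply: fr => //; split; rewrite /ball /=.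
      move: pp1 q1; rewrite /ball /= => pp1 q1.
      rewrite (le_lt_trans (ler_distD p'.1 _ _))//. lra.
    move: pp2 q2; rewrite /ball /= => pp2 q2.
    by rewrite (le_lt_trans (ler_distD p'.2 _ _))//; lra.
  rewrite (le_trans (ler_distD (sval f p) _ _))// (distrC _ (sval f p)); lra.
move=> n _ /(_ n (leqnn n)) H; exists n => p q Ip Iq; exact: H.
Unshelve. all: by end_near. Qed.

(** Half-open cells of side [1 / n.+1], indexed by their upper right corner. The
    index [0] gives cells that meet the square in its left or lower edge only,
    so that the whole square is covered. *)
Definition cell (n : nat) (k : 'I_n.+2 * 'I_n.+2) : set (R * R) :=
  MID ((k.1%:R - 1) / n.+1%:R) (k.1%:R / n.+1%:R)
      ((k.2%:R - 1) / n.+1%:R) (k.2%:R / n.+1%:R).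

Definition corner (n : nat) (k : 'I_n.+2 * 'I_n.+2) : R * R :=
  (k.1%:R / n.+1%:R, k.2%:R / n.+1%:R).

Lemma corner_I01sq n k : I01sq (@corner n k).
Proof.
have H (i : 'I_n.+2) : I01 (i%:R / n.+1%:R : R).
  rewrite /I01 /= in_itv/= divr_ge0//= ler_pdivrMr ?ltr0n// mul1r ler_nat.
  by rewrite -ltnS ltn_ord.
by split; exact: H.
Qed.

Lemma grid_coord n (x : R) : 0 <= x <= 1 ->
  exists i : 'I_n.+2, (i%:R - 1) / n.+1%:R < x <= i%:R / n.+1%:R.
Proof.
move=> /andP[x0 x1].
have Pn : exists i : nat, x <= i%:R / n.+1%:R.
  by exists n.+1; rewrite divff ?pnatr_eq0.
case: (ex_minnP Pn) => i xi imin.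
have iN : (i < n.+2)%N by rewrite ltnS imin// divff ?pnatr_eq0.
exists (Ordinal iN); rewrite /= xi andbT.
case: i xi imin {iN} => [|i] xi imin.
  by rewrite (lt_le_trans _ x0)// pmulr_llt0 ?invr_gt0 ?ltr0n// sub0r ltrN10.
rewrite -natr1 addrK ltNge; apply/negP => /imin.
by rewrite ltnn.
Qed.

Lemma grid_uniq (n : nat) (x : R) (i j : nat) :
  (i%:R - 1) / n.+1%:R < x <= i%:R / n.+1%:R ->
  (j%:R - 1) / n.+1%:R < x <= j%:R / n.+1%:R -> i = j.
Proof.
move=> /andP[i1 i2] /andP[j1 j2]; apply/eqP; rewrite eqn_leq.
have key (a b : nat) : (a%:R - 1) / n.+1%:R < x -> x <= b%:R / n.+1%:R -> (a <= b)%N.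
  move=> ax xb; have := lt_le_trans ax xb.
  by rewrite ltr_pM2r ?invr_gt0 ?ltr0n// ltrBlDr natr1 ltr_nat ltnS.
by rewrite !key.
Qed.

Definition grid_step f n (p : R * R) : R :=
  \sum_(k : 'I_n.+2 * 'I_n.+2) sval f (corner k) * \1_(cell k) p.

Lemma grid_stepE f n k p : @cell n k p -> grid_step f n p = sval f (corner k).
Proof.
move=> kp; rewrite /grid_step (bigD1 k)//= indicE mem_set// mulr1 big1 ?addr0//.
move=> l lk; rewrite indicE memNset ?mulr0// => lp; move/eqP: lk; apply.
move: kp lp; rewrite /cell !MIDE => /andP[k1 k2] /andP[l1 l2].
rewrite (surjective_pairing l) (surjective_pairing k); congr (_, _); apply: val_inj.
  exact: grid_uniq l1 k1.
exact: grid_uniq l2 k2.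
Qed.

Lemma grid_step_approx f n e p : oscillation_le f n.+1%:R^-1 e -> I01sq p ->
  `|sval f p - grid_step f n p| <= e.
Proof.
move=> osc [Ip1 Ip2].
have [i ip] := @grid_coord n p.1 (ltac:(by move: Ip1; rewrite /I01 /= in_itv)).
have [j jp] := @grid_coord n p.2 (ltac:(by move: Ip2; rewrite /I01 /= in_itv)).
have kp : cell (i, j) p by rewrite /cell MIDE ip jp.
have near (x u w : R) : u - w < x <= u -> `|x - u| <= w.
  by move=> /andP[? ?]; rewrite ler_norml; apply/andP; split; lra.
rewrite (grid_stepE f kp); apply: osc => //; first exact: corner_I01sq.
  by apply: near; move: ip; rewrite mulrBl mul1r.
by apply: near; move: jp; rewrite mulrBl mul1r.
Qed.

Lemma measurable_cell n k : measurable (@cell n k).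
Proof. exact: measurable_MID. Qed.

Lemma grid_step_integrable f n g :
  g.-integrable (@I01sq R) (EFin \o grid_step f n).
Proof.
have mI := @measurable_I01sq R.
rewrite (_ : EFin \o _ = fun p => \sum_(k : 'I_n.+2 * 'I_n.+2)
    (sval f (corner k))%:E * (\1_(cell k) p)%:E)%E; last first.
  by apply/funext => p /=; rewrite /grid_step -sumEFin.
apply: integrable_sum => // k _; apply: integrableZl => //.
by apply: integrableS (integrable_indic _ _) => //; exact: measurable_cell.
Qed.

Lemma grid_step_integral f n g : \int[g]_(p in @I01sq R) grid_step f n p =
  \sum_(k : 'I_n.+2 * 'I_n.+2) sval f (corner k) * fine (g (cell k)).
Proof.
have mI := @measurable_I01sq R.
have ik k : g.-integrable (@I01sq R)
    (fun p => (sval f (@corner n k))%:E * (\1_(cell k) p)%:E)%E.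
  apply: integrableZl => //.
  by apply: integrableS (integrable_indic _ _) => //; exact: measurable_cell.
rewrite /Rintegral.
transitivity (fine (\sum_(k : 'I_n.+2 * 'I_n.+2)
    (sval f (corner k) * fine (g (cell k)))%:E)); last by rewrite sumEFin.
congr fine.
rewrite (eq_integral (fun p => \sum_(k : 'I_n.+2 * 'I_n.+2)
    (sval f (corner k))%:E * (\1_(cell k) p)%:E)%E); last first.
  by move=> p _; rewrite /grid_step -sumEFin.
rewrite integral_sum//; apply: eq_bigr => k _.
rewrite integralZl//; last first.
  by apply: integrableS (integrable_indic _ _) => //; exact: measurable_cell.
rewrite integral_indic//; last exact: measurable_cell.
rewrite [X in (_ * X)%E]fmeasI//; last exact: measurable_cell.
by rewrite EFinM fineK// fmeas_fin//; exact: measurable_cell.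
Qed.

Lemma grid_sum_approx f n e g : oscillation_le f n.+1%:R^-1 e ->
  `|M01sq_int g f -
    \sum_(k : 'I_n.+2 * 'I_n.+2) sval f (corner k) * fine (g (cell k))|
  <= e * fine (g (@I01sq R)).
Proof.
move=> osc; have mI := @measurable_I01sq R.
have fi := C01sq_integrable f g; have si := grid_step_integrable f n g.
rewrite -grid_step_integral /M01sq_int -RintegralB//.
have di : g.-integrable (@I01sq R) (EFin \o (fun p => sval f p - grid_step f n p)).
  by have := integrableB mI fi si; apply: eq_integrable.
rewrite (le_trans (le_normr_Rintegral mI di))//.
rewrite -Rintegral_cst//; apply: le_Rintegral => //.
- by have := integrable_norm di.
- by apply: finite_measure_integrable_cst.
by move=> p Ip; exact: grid_step_approx.
Qed.

End test_functions.

(** * Continuity of [Psi] *)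

Section continuity.
Context (R : realType).

Lemma MID_SW (g : {finite_measure set (R * R)%type -> \bar R}) (a1 a2 b1 b2 : R) :
  a1 <= a2 -> b1 <= b2 -> fine (g (MID a1 a2 b1 b2)) =
  fine (g (SW a2 b2)) - fine (g (SW a1 b2)) -
  (fine (g (SW a2 b1)) - fine (g (SW a1 b1))).
Proof.
move=> a12 b12.
pose strip b : set (R * R) := `]a1, a2]%classic `*` `]-oo, b]%classic.
have mstrip b : measurable (strip b) by exact: measurableX.
have stripE b p : strip b p = ((a1 < p.1 <= a2) && (p.2 <= b)) :> Prop.
  apply/propext; rewrite /strip /setX /= !in_itv/=.
  by split=> [[-> ->]|/andP[-> ->]].
have add (A B C : set (R * R)) : measurable A -> measurable B ->
    A `&` B = set0 -> C = A `|` B -> fine (g C) = fine (g A) + fine (g B).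
  by move=> mA mB AB ->; rewrite measureU// fineD// fin_num_measure.
have SWD b : fine (g (SW a2 b)) = fine (g (SW a1 b)) + fine (g (strip b)).
  apply: add => //; apply/seteqP; split=> // p /=; rewrite ?SWE ?stripE.
  - by case=> /andP[pa _] /andP[/andP[+ _] _]; rewrite ltNge pa.
  - by move=> /andP[-> ->]; rewrite !andbT; case: leP => _; [left|right].
  - by case=> [/andP[/le_trans->]|/andP[/andP[_ ->] ->]].
have stripD : fine (g (strip b2)) = fine (g (strip b1)) + fine (g (MID a1 a2 b1 b2)).
  apply: add => //; first exact: measurable_MID.
    apply/seteqP; split=> // p /=; rewrite stripE MIDE.
    by case=> /andP[_ pb] /andP[_ /andP[+ _]]; rewrite ltNge pb.
  apply/seteqP; split=> // p /=; rewrite !stripE MIDE.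
    by move=> /andP[-> ->]; rewrite !andbT /=; case: leP => _; [left|right].
  by case=> [/andP[-> /le_trans->]|/andP[-> /andP[_ ->]]].
by rewrite !SWD stripD; lra.
Qed.

Lemma cvg_minr (T : Type) (F : set_system T) (FF : Filter F) (u v : T -> R) (a b : R) :
  u @ F --> a -> v @ F --> b -> Num.min (u t) (v t) @[t --> F] --> Num.min a b.
Proof.
move=> ua vb; under eq_fun do rewrite minr_absE.
rewrite minr_absE; apply: cvgM; [|exact: cvg_cst]; apply: cvgB; first exact: cvgD.
by apply: cvg_norm; apply: cvgB.
Qed.

Section at_point.
Variable p0 : M01 R * M01 R.
Hypothesis Dp0 : calD p0.

Let F := within (@calD R) (nbhs p0).

Let FF : Filter F. Proof. exact: within_filter. Qed.

Let near_D : \forall p \near F, calD p.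
Proof. by rewrite /F near_withinE; apply: nearW. Qed.

Let fst_cvg : fst @ F --> p0.1.
Proof.
apply: cvg_trans (@cvg_fst _ _ (nbhs p0.1) (nbhs p0.2) _).
by apply: cvg_fmap2; exact: (@cvg_within _ (nbhs p0)).
Qed.

Let snd_cvg : snd @ F --> p0.2.
Proof.
apply: cvg_trans (@cvg_snd _ _ (nbhs p0.1) (nbhs p0.2) _).
by apply: cvg_fmap2; exact: (@cvg_within _ (nbhs p0)).
Qed.

Lemma leb_sub_cdf1 (pi : M01 R) x : le_leb pi ->
  cdf1 (leb_sub pi) x = fine (leb01 `]-oo, x]%classic) - cdf1 pi x.
Proof.
by move=> le_pi; rewrite /cdf1 leb_subE// fineB// ?fmeas_fin// fin_num_measure.
Qed.

(** The joint distribution function of [Psi p] is a continuous expression in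
    values of the distribution functions of [p.1] and [p.2]. *)
Lemma Psi_SW_cvg a b :
  fine (Psi p (SW a b)) @[p --> F] --> fine (Psi p0 (SW a b)).
Proof.
have [le1 le2 _ _] := Dp0.
pose l x := fine (@leb01 R `]-oo, x]%classic).
pose H (p : M01 R * M01 R) := Num.min (cdf1 p.1 a) (cdf1 p.2 b) +
   Num.min (l a - cdf1 p.1 a) (l b - cdf1 p.2 b).
have HE p : calD p -> fine (Psi p (SW a b)) = H p.
  move=> Dp; have [? ? _ _] := Dp.
  by rewrite Psi_SW//= !leb_sub_cdf1.
rewrite HE//; apply: (@cvg_trans _ (H @ F)).
  by apply: near_eq_cvg; near=> p; rewrite HE//; near: p.
have c1 x : cdf1 p.1 x @[p --> F] --> cdf1 p0.1 x.
  by apply: cdf1_cvg => //; near=> p; have [] : calD p by near: p.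
have c2 x : cdf1 p.2 x @[p --> F] --> cdf1 p0.2 x.
  by apply: cdf1_cvg => //; near=> p; have [] : calD p by near: p.
by apply: cvgD; apply: cvg_minr => //; apply: cvgB => //; exact: cvg_cst.
Unshelve. all: by end_near. Qed.

Lemma Psi_MID_cvg a1 a2 b1 b2 : a1 <= a2 -> b1 <= b2 ->
  fine (Psi p (MID a1 a2 b1 b2)) @[p --> F] --> fine (Psi p0 (MID a1 a2 b1 b2)).
Proof.
move=> a12 b12; rewrite MID_SW//; under eq_fun do rewrite MID_SW//.
by apply: cvgB; apply: cvgB; exact: Psi_SW_cvg.
Qed.

(** The grid depends on [f] and [e] only, so the approximation of the integral
    by a grid sum is uniform in [p]. *)
Lemma Psi_int_cvg (f : C01sq R) :
  M01sq_int (Psi p) f @[p --> F] --> M01sq_int (Psi p0) f.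
Proof.
apply/cvgrPdist_le => e e0.
have e3 : 0 < e / 3 by rewrite divr_gt0.
have [n osc] := C01sq_oscillation f e3.
pose S (p : M01 R * M01 R) :=
  \sum_(k : 'I_n.+2 * 'I_n.+2) sval f (corner R k) * fine (Psi p (cell k)).
have approx p : calD p -> `|M01sq_int (Psi p) f - S p| <= e / 3.
  move=> Dp; have := grid_sum_approx (Psi p) osc.
  by have [[-> _ _] _] := Psi_permuton321 Dp; rewrite mulr1.
have cS : S p @[p --> F] --> S p0.
  apply: cvg_big => [|k _]; first exact: add_continuous.
  apply: cvgM; first exact: cvg_cst.
  by apply: Psi_MID_cvg; rewrite ler_pM2r ?invr_gt0 ?ltr0n// lerBlDr lerDl.
move/cvgrPdist_le : cS => /(_ _ e3) cS.
near=> p.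
have : `|M01sq_int (Psi p) f - S p| <= e / 3 by apply: approx; near: p.
have := approx _ Dp0.
have : `|S p0 - S p| <= e / 3 by near: p.
by rewrite !ler_norml => /andP[? ?] /andP[? ?] /andP[? ?]; apply/andP; split; lra.
Unshelve. all: by end_near. Qed.

End at_point.

Lemma Psi_continuous : {within @calD R, continuous (@Psi R)}.
Proof.
by apply: within_continuous_M01sq => f p0 Dp0; exact: Psi_int_cvg.
Qed.

End continuity.

Theorem proposition3 (R : realType) :
  [/\ {within @calD R, continuous (@Psi R)},
      forall p : M01 R * M01 R, calD p -> permuton321 (Psi p) &
      forall mu : M01sq R, permuton321 mu ->
        exists2 p : M01 R * M01 R, calD p & eq_meas (Psi p) mu].
Proof.
split; first exact: Psi_continuous.
  by move=> p; exact: Psi_permuton321.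
by move=> mu; exact: Psi_surjective.
Qed.
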